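(* Let $R(\mathbf{x},\mathbf{x}')$ be a balanced difference bounds constraint over $N$ variables, let $n\ge1$, and let $\rho$ be a path in $\mathcal{G}_R^n$ between extremal vertices. Then there exists a normalized path $\rho'$ in $\mathcal{G}_R^n$ that is compatible with $\rho$.
   Context: Variables range over $\mathbb{Z}$; $\mathbf{x}=\{x_1,\dots,x_N\}$, $\mathbf{x}'$ its primed copy. A difference bounds constraint is a finite conjunction of atoms $u-v\le c$, $c\in\mathbb{Z}$; its constraint graph has the variables as vertices and an edge $u\xrightarrow{c}v$ per atom $u-v\le c$. $R$ is balanced if $x_i-x_j\le c$ is an atom of $R$ iff $x_i'-x_j'\le c$ is. For $p\in\mathbb{Z}$ let $x_i^{(p)}$ be fresh copies of $x_i$; the vertex $x_i^{(p)}$ has position $p$. The $n$-times unfolding $\mathcal{G}_R^n$ is the union over $p=0,\dots,n-1$ of the constraint graphs of $R(\mathbf{x}^{(p)},\mathbf{x}^{(p+1)})$; its extremal vertices are those at positions $0$ and $n$. A path is a sequence of vertices consecutive ones joined by edges (at least one vertex); its weight is the sum of edge weights, $\mathrm{positions}(\rho)$ is the set of positions of its vertices; a subpath is a contiguous subsequence. A path $\rho'$ is compatible with $\rho$ if both have the same first vertex and the same last vertex and the weight of $\rho'$ is at most that of $\rho$. A corner is a path with at least one edge whose first and last vertex have the same position $k_0$; it is a right corner of extent $d\ge0$ if its set of positions is $\{k_0,\dots,k_0+d\}$, a left corner of extent $d$ if it is $\{k_0-d,\dots,k_0\}$. A corner is long if its extent exceeds $N^2$. A path $\rho$ in $\mathcal{G}_R^n$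 between extremal vertices is normalized if none of its subpaths $\theta$ with $\mathrm{positions}(\theta)\subseteq\{N^2,\dots,n-N^2\}$ is a long corner. *)

(* Defs.v *)
From mathcomp Require Import all_boot all_order all_algebra.

Set Implicit Arguments.
Unset Strict Implicit.
Unset Printing Implicit Defensive.

Import Order.TTheory GRing.Theory Num.Theory.
Local Open Scope ring_scope.

(* The atom u - v <= c is encoded as the triple (u, v, c). *)
Definition atom (V : Type) : Type := (V * V * int)%type.

(* The conjunction of the listed atoms; the same pair (u, v) may occur with
   several bounds c. *)
Definition constraint (V : Type) : Type := seq (atom V).

Definition rename (V W : Type) (f : V -> W) (phi : constraint V) :
    constraint W :=
  [seq (f a.1.1, f a.1.2, a.2) | a <- phi].

Record wgraph (V : Type) := WGraph {
  vertex : pred V;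
  edge : V -> int -> V -> bool (* edge u c v : there is an edge u --c--> v *)
}.

Definition constraint_graph (V : eqType) (X : seq V) (phi : constraint V) :
    wgraph V :=
  WGraph (fun u => u \in X) (fun u c v => (u, v, c) \in phi).

(* inl i is the variable x_i, inr i is x'_i. *)
Definition var (N : nat) : Type := ('I_N + 'I_N)%type.

Definition dbc (N : nat) : Type := constraint (var N).

Definition balanced (N : nat) (R : dbc N) : Prop :=
  forall (i j : 'I_N) (c : int),
    ((inl i, inl j, c) : atom (var N)) \in R <->
    ((inr i, inr j, c) : atom (var N)) \in R.

(* (i, p) is the copy x_i^(p). *)
Definition pvar (N : nat) : Type := ('I_N * int)%type.

Definition position (N : nat) (z : pvar N) : int := z.2.

(* The substitution sending x to x^(p) and x' to x^(p+1). *)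
Definition copy (N : nat) (p : int) (u : var N) : pvar N :=
  match u with
  | inl i => (i, p)
  | inr i => (i, p + 1)
  end.

Definition step_graph (N : nat) (R : dbc N) (p : int) : wgraph (pvar N) :=
  constraint_graph (codom (@copy N p)) (rename (@copy N p) R).

Definition unfolding (N : nat) (R : dbc N) (n : nat) : wgraph (pvar N) :=
  WGraph (fun z => [exists p : 'I_n, vertex (step_graph R p%:Z) z])
         (fun u c v => [exists p : 'I_n, edge (step_graph R p%:Z) u c v]).

(* A path v0 --c1--> v1 --c2--> ... --ck--> vk is stored as v0 together with
   the steps (c1, v1), ..., (ck, vk). The edge labels are recorded because two
   vertices may be joined by several edges of different weights. *)
Record gpath (V : Type) := GPath { first : V; steps : seq (int * V) }.

Fixpoint is_walk (V : Type) (G : wgraph V) (u : V) (s : seq (int * V)) : bool :=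
  if s is (c, v) :: s' then edge G u c v && is_walk G v s' else true.

Section Paths.
Variable V : Type.
Implicit Types (G : wgraph V) (rho theta : gpath V).

Definition vertices rho : seq V := first rho :: [seq e.2 | e <- steps rho].

Definition final rho : V := last (first rho) [seq e.2 | e <- steps rho].

Definition weight rho : int := \sum_(e <- steps rho) e.1.

Definition is_path G rho : bool :=
  all (vertex G) (vertices rho) && is_walk G (first rho) (steps rho).

Definition subpath theta rho : Prop :=
  exists s1 s2 : seq (int * V),
    steps rho = s1 ++ steps theta ++ s2 /\
    first theta = last (first rho) [seq e.2 | e <- s1].

Definition compatible rho' rho : Prop :=
  [/\ first rho' = first rho, final rho' = final rho &
      weight rho' <= weight rho].

End Paths.

Definition positions (N : nat) (rho : gpath (pvar N)) : seq int :=
  [seq position z | z <- vertices rho].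

Definition corner (N : nat) (theta : gpath (pvar N)) : Prop :=
  (0 < size (steps theta))%N /\
  position (first theta) = position (final theta).

Definition right_corner (N : nat) (d : nat) (theta : gpath (pvar N)) : Prop :=
  corner theta /\
  (let k0 := position (first theta) in
   forall k : int, k \in positions theta <-> k0 <= k <= k0 + d%:Z).

Definition left_corner (N : nat) (d : nat) (theta : gpath (pvar N)) : Prop :=
  corner theta /\
  (let k0 := position (first theta) in
   forall k : int, k \in positions theta <-> k0 - d%:Z <= k <= k0).

Definition long_corner (N : nat) (theta : gpath (pvar N)) : Prop :=
  exists d : nat,
    (right_corner d theta \/ left_corner d theta) /\ (N ^ 2 < d)%N.

Definition extremal (N n : nat) (z : pvar N) : Prop :=
  position z = 0 \/ position z = n%:Z.

Definition extremal_path (N : nat) (R : dbc N) (n : nat)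
    (rho : gpath (pvar N)) : Prop :=
  [/\ is_path (unfolding R n) rho, extremal n (first rho) &
      extremal n (final rho)].

(* The bound n - N^2 is computed in int, so the range is empty when
   n < 2 N^2. *)
Definition normalized (N : nat) (R : dbc N) (n : nat)
    (rho : gpath (pvar N)) : Prop :=
  extremal_path R n rho /\
  forall theta : gpath (pvar N),
    subpath theta rho ->
    (forall k : int, k \in positions theta ->
       (N ^ 2)%N%:Z <= k <= n%:Z - (N ^ 2)%N%:Z) ->
    ~ long_corner theta.

(* Main.v *)
Require Import Defs.
From mathcomp Require Import all_boot all_order all_algebra zify.
From Stdlib Require Import Classical.

(* On a long corner, pigeonhole on the pairs of variables met at the same level
   on the way out and on the way back gives a factorization  s1 X M Y s2  in
   which X goes from a to a copy of a shifted by some 0 < d <= N^2, and Y goes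
   from a copy of b shifted by d to b.  By shift invariance X and Y may be cut
   out (M is shifted back) or repeated (M is shifted further out); if the corner
   lies in {N^2, ..., n - N^2}, repeating them once stays inside the unfolding.

   If no closed walk between the end points u, v of rho has negative weight, a
   path of minimal weight, and of minimal length among those, is normalized:
   cutting and repeating change the weight by opposite amounts.

   Otherwise let f = al * weight - be * length vanish on the closed walks of
   least (negative) mean weight and be nonnegative on all others; call the
   vertices of the former critical.
   - If some critical z lies outside {N^2, ..., n - N^2}, a shortest cycle C
     through z with f C = 0 has no long corner, and neither has P C^k Q with P, Q
     shortest paths u -> z -> v, as no relevant corner passes through z.
   - Otherwise take a critical z of maximal position and a cycle C through it.
     No copy of C shifted upwards can be met on a path from u to v.  Take
     P C^k Q with P a shortest path to z from w1 and Q a shortest path from z to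
     w2, where w1 and w2 are below N^2 if possible, and are u and v otherwise.
     A right corner whose X M Y meets C would, after one repetition, meet C
     shifted upwards; otherwise X M Y lies in P or in Q, and can be cut.  For a
     left corner, cutting shows that M does not meet C, so M lies in, say, Q; if
     X starts before Q, repeating X and Y leads below N^2, so w2 is below N^2, and
     then Q turns around once more and can be cut. *)

Set Implicit Arguments.
Unset Strict Implicit.
Unset Printing Implicit Defensive.

Import Order.TTheory GRing.Theory Num.Theory.
Local Open Scope ring_scope.

(** * Sequences of steps: end points, vertices, segments and factorizations *)

Definition endv (V : Type) (x : V) (s : seq (int * V)) : V :=
  last x [seq e.2 | e <- s].

Definition verts (V : Type) (x : V) (s : seq (int * V)) : seq V :=
  x :: [seq e.2 | e <- s].

Definition wt (V : Type) (s : seq (int * V)) : int := \sum_(e <- s) e.1.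

Definition vtx (V : Type) (x : V) (s : seq (int * V)) (t : nat) : V :=
  endv x (take t s).

Definition seg (V : Type) (s : seq (int * V)) (t t' : nat) : seq (int * V) :=
  take (t' - t) (drop t s).

Section Steps.
Variable V : Type.
Implicit Types (x : V) (s p : seq (int * V)).

Lemma endv_cat x s p : endv x (s ++ p) = endv (endv x s) p.
Proof. by rewrite /endv map_cat last_cat. Qed.

Lemma is_walk_cat (G : wgraph V) x s p :
  is_walk G x (s ++ p) = is_walk G x s && is_walk G (endv x s) p.
Proof. by elim: s x => [|[c y] s IHs] x //=; rewrite IHs andbA. Qed.

Lemma wt_cat s p : wt (s ++ p) = wt s + wt p.
Proof. by rewrite /wt big_cat. Qed.

Lemma vtx0 x s : vtx x s 0 = x.
Proof. by rewrite /vtx take0. Qed.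

Lemma vtx_size x s : vtx x s (size s) = endv x s.
Proof. by rewrite /vtx take_size. Qed.

Lemma take_seg s t t' : (t <= t')%N -> take t s ++ seg s t t' = take t' s.
Proof. by move=> le; rewrite /seg -takeD subnKC. Qed.

Lemma endv_seg x s t t' : (t <= t')%N -> endv (vtx x s t) (seg s t t') = vtx x s t'.
Proof. by move=> le; rewrite /vtx -endv_cat take_seg. Qed.

Lemma size_seg s t t' : (t' <= size s)%N -> size (seg s t t') = (t' - t)%N.
Proof. by move=> le; rewrite size_takel // size_drop leq_sub2r. Qed.

End Steps.

Section StepsEq.
Variable V : eqType.
Implicit Types (x y z : V) (s p q : seq (int * V)).

Lemma endv_verts x s : endv x s \in verts x s.
Proof. exact: mem_last. Qed.

Lemma mem_verts_cat x s p z :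
  (z \in verts x (s ++ p)) = (z \in verts x s) || (z \in verts (endv x s) p).
Proof.
rewrite /verts map_cat -cat_cons mem_cat -/(verts x s) in_cons.
by case: (z =P endv x s) => [->|] //=; rewrite endv_verts.
Qed.

Lemma mem_verts_split x s z :
  z \in verts x s -> exists s1 s2, s = s1 ++ s2 /\ endv x s1 = z.
Proof.
elim: s x => [|[c y] s IHs] x; first by rewrite inE => /eqP ->; exists [::], [::].
rewrite in_cons => /orP[/eqP->|/IHs[s1 [s2 [-> <-]]]].
  by exists [::], ((c, y) :: s).
by exists ((c, y) :: s1), s2.
Qed.

Lemma cat_prefix (p q s r : seq (int * V)) :
  p ++ q = s ++ r -> (size p <= size s)%N -> exists t, s = p ++ t /\ q = t ++ r.
Proof.
move=> e le; exists (drop (size p) s).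
have es : s = p ++ drop (size p) s.
  by rewrite -{1}(cat_take_drop (size p) s) -(takel_cat r le) -e take_size_cat.
split=> //; move: e; rewrite {1}es -catA => /eqP.
by rewrite eqseq_cat // eqxx => /eqP.
Qed.

(** A factor reaching into both [p] and [q] would visit their junction. This confines a hump to one
    piece of a concatenation. *)
Lemma subwalk_split x p q s t r :
  p ++ q = s ++ t ++ r -> endv x p \notin verts (endv x s) t ->
  (exists r', p = s ++ t ++ r' /\ r = r' ++ q) \/
  (exists s', s = p ++ s' /\ q = s' ++ t ++ r).
Proof.
move=> e nin; case: (leqP (size p) (size s)) => [le|lt].
  by right; apply: cat_prefix e le.
have [p' [ep e']] := cat_prefix (esym e) (ltnW lt).
case: (leqP (size t) (size p')) => [le|lt'].
  by have [r' [ep' er]] := cat_prefix e' le; left; exists r'; rewrite ep ep'.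
have [t' [et _]] := cat_prefix (esym e') (ltnW lt').
by move: nin; rewrite ep et endv_cat mem_verts_cat endv_verts.
Qed.

Lemma mem_verts_vtx x s z :
  z \in verts x s -> exists2 t, (t <= size s)%N & z = vtx x s t.
Proof.
case/mem_verts_split=> s1 [s2 [-> <-]]; exists (size s1).
  by rewrite size_cat leq_addr.
by rewrite /vtx take_size_cat.
Qed.

Lemma mem_verts_seg x s t t' z : (t <= t' <= size s)%N ->
  z \in verts (vtx x s t) (seg s t t') ->
  exists2 r, (t <= r <= t')%N & z = vtx x s r.
Proof.
case/andP=> le le' /mem_verts_vtx[r]; rewrite size_seg // => ler ->.
exists (t + r)%N; first lia.
by rewrite /vtx /seg take_takel // takeD endv_cat.
Qed.

End StepsEq.

(** * Level crossings and the pigeonhole argument *)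

(** Discrete intermediate values: as [H] rises by at most 1 per step, the last time before [t0] at
    which it is at most [l], it equals [l]. *)
Lemma last_level (H : nat -> int) (l : int) (t0 : nat) :
  H 0%N <= l -> l < H t0 -> (forall t, (t < t0)%N -> H t.+1 <= H t + 1) ->
  exists t, [/\ (t < t0)%N, H t = l & forall r, (t < r <= t0)%N -> l < H r].
Proof.
elim: t0 => [|t0 IH] H0 Ht0 Hs; first lia.
have [le|lt] := lerP (H t0) l.
  exists t0; split=> //; first by have := Hs t0 (ltnSn _); lia.
  by move=> r rt; have -> : r = t0.+1 by lia.
have [|t [tt0 Ht Hr]] := IH H0 lt; first by move=> t tt0; apply: Hs; lia.
exists t; split=> //; first lia.
move=> r rt; have [->|ne] := eqVneq r t0.+1; first by [].
by apply: Hr; lia.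
Qed.

(** This is [last_level] with time reversed. *)
Lemma first_level (H : nat -> int) (l : int) (t0 te : nat) :
  (t0 <= te)%N -> H te <= l -> l < H t0 ->
  (forall t, (t < te)%N -> H t <= H t.+1 + 1) ->
  exists t, [/\ (t0 < t <= te)%N, H t = l & forall r, (t0 <= r < t)%N -> l < H r].
Proof.
move=> t0te Hte Ht0 Hs.
have [||t tlt|t [tlt Ht Hr]] :=
  @last_level (fun r => H (te - r)%N) l (te - t0)%N.
- by rewrite subn0.
- by have -> : (te - (te - t0) = t0)%N by lia.
- have -> : (te - t = (te - t.+1).+1)%N by lia.
  by apply: Hs; lia.
exists (te - t)%N; split=> //; first lia.
move=> r rt; have -> : r = (te - (te - r))%N by lia.
by apply: Hr; lia.
Qed.

Lemma hump_indices (N : nat) (H : nat -> int) (st : nat -> 'I_N) (t0 te : nat) :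
  (t0 <= te)%N -> H 0%N <= 0 -> H te <= 0 -> (N ^ 2)%N%:Z < H t0 ->
  (forall t, (t < te)%N -> `|H t.+1 - H t| <= 1) ->
  exists t1 t2 t3 t4 (d : nat),
    [/\ [/\ (t1 < t2)%N, (t2 <= t0)%N, (t0 <= t3)%N, (t3 < t4)%N & (t4 <= te)%N],
        (0 < d <= N ^ 2)%N,
        st t1 = st t2 /\ H t2 = H t1 + d%:Z,
        st t4 = st t3 /\ H t3 = H t4 + d%:Z &
        forall t, (t2 <= t <= t3)%N -> d%:Z <= H t].
Proof.
move=> t0te H0 Hte Ht0 Hs.
have /fin_all_exists[a Ha] : forall l : 'I_(N ^ 2).+1, exists t,
    [/\ (t < t0)%N, H t = (l : nat)%:Z &
        forall r, (t < r <= t0)%N -> (l : nat)%:Z < H r].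
  move=> l; have := ltn_ord l => ll.
  by apply: last_level; [lia|lia|move=> t tt; have := Hs t; lia].
have /fin_all_exists[b Hb] : forall l : 'I_(N ^ 2).+1, exists t,
    [/\ (t0 < t <= te)%N, H t = (l : nat)%:Z &
        forall r, (t0 <= r < t)%N -> (l : nat)%:Z < H r].
  move=> l; have := ltn_ord l => ll.
  by apply: first_level; [lia|lia|lia|move=> t tt; have := Hs t; lia].
(* There are N^2 + 1 levels but only N^2 pairs of variables. *)
have : ~~ injectiveb (fun l => (st (a l), st (b l))).
  apply/negP => /injectiveP /leq_card; rewrite card_prod !card_ord; lia.
case/injectivePn=> l [l']; wlog ll' : l l' / (l < l')%N => [th ne e|_ [ea eb]].
  case: (ltngtP l l') => [lt|lt|/val_inj ee]; first exact: (th l l').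
  - by apply: (th l' l); rewrite // eq_sym.
  - by rewrite ee eqxx in ne.
have [a1 a2 a3] := Ha l; have [a1' a2' a3'] := Ha l'.
have [b1 b2 b3] := Hb l; have [b1' b2' b3'] := Hb l'.
have := ltn_ord l' => lN.
exists (a l), (a l'), (b l'), (b l), (l' - l)%N; split; first split; try lia.
- rewrite ltnNge; apply/negP => le; have [e|ne] := eqVneq (a l) (a l').
    by move: a2; rewrite e a2'; lia.
  by have := a3' (a l); rewrite a2; lia.
- rewrite ltnNge; apply/negP => le; have [e|ne] := eqVneq (b l) (b l').
    by move: b2; rewrite e b2'; lia.
  by have := b3' (b l); rewrite b2; lia.
- by split=> //; rewrite a2 a2'; lia.
- by split=> //; rewrite b2 b2'; lia.
- move=> t tt; have [->|ne] := eqVneq t (a l'); first by rewrite a2'; lia.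
  have [->|ne'] := eqVneq t (b l'); first by rewrite b2'; lia.
  have [le|lt] := leqP t t0; first by have := a3' t; lia.
  by have := b3' t; lia.
Qed.

Definition shift (N : nat) (d : int) (z : pvar N) : pvar N := (z.1, z.2 + d).

Definition shifts (N : nat) (d : int) (s : seq (int * pvar N)) :
    seq (int * pvar N) :=
  [seq (e.1, shift d e.2) | e <- s].

(** * Walks in the unfolding, cutting and repeating humps *)

Section Unfolding.
Variables (N : nat) (R : dbc N) (n : nat).
Hypotheses (balR : balanced R) (n_gt0 : (0 < n)%N).
Local Notation V := (pvar N).
Local Notation G := (unfolding R n).
Local Notation inG z := (0 <= z.2 <= n%:Z).
Local Notation inA z := ((N ^ 2)%N%:Z <= z.2 <= n%:Z - (N ^ 2)%N%:Z).
Implicit Types (x y z a b u v : V) (s p q r : seq (int * V)) (d : int).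

(** Only the difference [d] of positions enters. Atoms between primed variables are absent, being
    copies of the unprimed ones by balance. *)
Definition step_atom (i : 'I_N) (c d : int) (j : 'I_N) : bool :=
  [|| (d == 0) && ((inl i, inl j, c) \in R),
      (d == 1) && ((inl i, inr j, c) \in R) |
      (d == -1) && ((inr i, inl j, c) \in R)].

(** Balance makes the edges within a level the same everywhere: position 0 only sees unprimed atoms,
    position n only primed ones. *)
Lemma edgeE x c y :
  edge G x c y = [&& inG x, inG y & step_atom x.1 c (y.2 - x.2) y.1].
Proof.
apply/existsP/and3P => [[[k kn] /= /mapP[[[[i|i] [j|j]] c'] aR [-> -> ->]]]|].
- by split; rewrite /step_atom /= ?subrr ?aR //; lia.
- by split; rewrite /step_atom /= ?aR; lia.
- by split; rewrite /step_atom /= ?aR; lia.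
- by split; rewrite /step_atom /=; [lia..|]; move/balR: aR => ->; lia.
case: x => i k; case: y => j l /= [kn ln /or3P[] /andP[/eqP e aR]].
- have [lt|le] := ltP k n%:Z.
    have kn' : (`|k| < n)%N by lia.
    exists (Ordinal kn'); apply/mapP; exists (inl i, inl j, c) => //=.
    by congr (_, _, _); congr pair; lia.
  (* At position n no step begins, so the primed form of the atom in step n - 1 is used. *)
  have kn' : (n.-1 < n)%N by lia.
  exists (Ordinal kn'); apply/mapP; exists (inr i, inr j, c); first exact/balR.
  by congr (_, _, _); congr pair => /=; lia.
- have kn' : (`|k| < n)%N by lia.
  exists (Ordinal kn'); apply/mapP; exists (inl i, inr j, c) => //=.
  by congr (_, _, _); congr pair; lia.
- have kn' : (`|l| < n)%N by lia.
  exists (Ordinal kn'); apply/mapP; exists (inr i, inl j, c) => //=.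
  by congr (_, _, _); congr pair; lia.
Qed.

Lemma vertexE z : vertex G z = inG z.
Proof.
apply/existsP/idP => [[[k kn] /= /codomP[[i|i] ->]] /=|]; [lia..|].
case: z => i k /= kn; have [lt|le] := ltP k n%:Z.
  have kn' : (`|k| < n)%N by lia.
  exists (Ordinal kn'); apply/codomP; exists (inl i) => /=.
  by congr pair; lia.
have kn' : (n.-1 < n)%N by lia.
exists (Ordinal kn'); apply/codomP; exists (inr i) => /=.
by congr pair; lia.
Qed.

Definition walk x s y : Prop := is_walk G x s /\ endv x s = y.

Lemma is_walk_cons x c y s :
  is_walk G x ((c, y) :: s) =
  [&& inG x, inG y, step_atom x.1 c (y.2 - x.2) y.1 & is_walk G y s].
Proof.
by transitivity (edge G x c y && is_walk G y s); rewrite // edgeE -!andbA.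
Qed.

Lemma walk_cat x s y p z : walk x s y -> walk y p z -> walk x (s ++ p) z.
Proof. by move=> [w <-] [w' <-]; split; rewrite ?is_walk_cat ?w ?endv_cat. Qed.

Lemma walk_catP x s p z : walk x (s ++ p) z ->
  walk x s (endv x s) /\ walk (endv x s) p z.
Proof. by case; rewrite is_walk_cat endv_cat => /andP[w w'] <-. Qed.

Lemma walk_inG x s y z : inG x -> walk x s y -> z \in verts x s -> inG z.
Proof.
move=> xG [w _]; elim: s x w xG => [|[c t] s IHs] x; first by rewrite inE => _ xG /eqP ->.
rewrite is_walk_cons => /and4P[_ tG _ w] xG.
by rewrite in_cons => /orP[/eqP->//|]; apply: IHs.
Qed.

Lemma walk_end_inG x s y : inG x -> walk x s y -> inG y.
Proof. by move=> xG w; apply: (walk_inG xG w); case: w => _ <-; apply: endv_verts. Qed.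

Lemma endv_shifts x s d : endv (shift d x) (shifts d s) = shift d (endv x s).
Proof. by elim: s x => [|e s IHs] x //; apply: IHs. Qed.

Lemma verts_shifts x s d :
  verts (shift d x) (shifts d s) = [seq shift d z | z <- verts x s].
Proof. by rewrite /verts /shifts /= -!map_comp. Qed.

Lemma shifts_cat s p d : shifts d (s ++ p) = shifts d s ++ shifts d p.
Proof. exact: map_cat. Qed.

Lemma size_shifts s d : size (shifts d s) = size s.
Proof. exact: size_map. Qed.

Lemma wt_shifts s d : wt (shifts d s) = wt s.
Proof. by rewrite /wt big_map. Qed.

Lemma shiftD d d' z : shift d (shift d' z) = shift (d' + d) z.
Proof. by rewrite /shift /= addrA. Qed.

Lemma shift0 z : shift 0 z = z.
Proof. by case: z => i k; rewrite /shift /= addr0. Qed.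

Lemma shift_eq d z z' : z.1 = z'.1 -> z.2 = z'.2 + d -> z = shift d z'.
Proof. by case: z => i k /= -> ->. Qed.

Lemma walk_shift x s y d : walk x s y ->
  (forall z, z \in verts x s -> inG (shift d z)) ->
  walk (shift d x) (shifts d s) (shift d y).
Proof.
case=> w <- sG; split; last exact: endv_shifts.
elim: s x w sG => [|[c t] s IHs] x //.
rewrite is_walk_cons => /and4P[_ _ a w] sG.
have -> : shifts d ((c, t) :: s) = (c, shift d t) :: shifts d s by [].
have xG := sG x (mem_head _ _); have tG : inG (shift d t).
  by apply: sG; rewrite /verts /= !inE eqxx orbT.
rewrite is_walk_cons xG tG /=.
have -> : t.2 + d - (x.2 + d) = t.2 - x.2 by lia.
by rewrite a /=; apply: IHs => // z zs; apply: sG; rewrite in_cons [z \in _]zs orbT.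
Qed.

Lemma walk_vtx_step x s y t : walk x s y -> (t < size s)%N ->
  `|(vtx x s t.+1).2 - (vtx x s t).2| <= 1.
Proof.
case=> w _ lt; rewrite /vtx (take_nth (0, x)) // -cats1 endv_cat.
move: w; rewrite -{1}(cat_take_drop t s) (drop_nth (0, x)) // is_walk_cat.
case: (nth _ s t) => c y' /andP[_]; rewrite is_walk_cons /endv /= => /and4P[_ _].
by case/or3P => /andP[/eqP ->] _ _; rewrite ?normr0 ?normrN ?normr1.
Qed.

Lemma walk_seg x s y t t' : walk x s y -> (t <= t')%N ->
  walk (vtx x s t) (seg s t t') (vtx x s t').
Proof.
move=> [w _] le; split; last exact: endv_seg.
have es : s = take t s ++ seg s t t' ++ drop t' s.
  by rewrite catA take_seg // cat_take_drop.
by move: w; rewrite {1}es !is_walk_cat => /and3P[].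
Qed.

(* The sign e selects the side: for e = 1 the walk rises above the level k0 by
   more than N^2, for e = -1 it falls below it. *)
Record hump (e : int) (k0 : int) x s y (y0 : V) : Prop := Hump {
  hump_walk : walk x s y;
  hump_start : e * (x.2 - k0) <= 0;
  hump_end : e * (y.2 - k0) <= 0;
  hump_mem : y0 \in verts x s;
  hump_high : (N ^ 2)%N%:Z < e * (y0.2 - k0) }.

(** [hs_X] makes the cut walk strictly shorter; [hs_high] keeps [M] in the unfolding when it is
    shifted back. *)
Record hump_split (e : int) (k0 : int) x s y (y0 : V)
    s1 X M Y s2 a b (d : int) : Prop := HumpSplit {
  hs_eq : s = s1 ++ X ++ M ++ Y ++ s2;
  hs_X : (0 < size X)%N;
  hs_d : 0 < d <= (N ^ 2)%N%:Z;
  hs_w1 : walk x s1 a;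
  hs_wX : walk a X (shift (e * d) a);
  hs_wM : walk (shift (e * d) a) M (shift (e * d) b);
  hs_wY : walk (shift (e * d) b) Y b;
  hs_w2 : walk b s2 y;
  hs_high : forall z, z \in verts (shift (e * d) a) M -> d <= e * (z.2 - k0);
  hs_mem : y0 \in verts (shift (e * d) a) M }.

Lemma hump_splitP e k0 x s y y0 : e = 1 \/ e = -1 -> hump e k0 x s y y0 ->
  exists s1 X M Y s2 a b d, hump_split e k0 x s y y0 s1 X M Y s2 a b d.
Proof.
move=> e1 [w hx hy /mem_verts_vtx[t0 t0s ->] h0].
(* The height beyond [k0] on the side [e] treats both kinds of corners at once. *)
pose H t := e * ((vtx x s t).2 - k0).
have [|||||t1 [t2 [t3 [t4 [d [[l12 l20 l03 l34 l4] dN [st1 H1] [st2 H2] hi]]]]]] :=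
  @hump_indices N H (fun t => (vtx x s t).1) t0 (size s) => //.
- by rewrite /H vtx0.
- by rewrite /H vtx_size (proj2 w).
- move=> t ts; have := walk_vtx_step w ts; rewrite /H.
  by case: e1 => ->; lia.
have sh1 : vtx x s t2 = shift (e * d%:Z) (vtx x s t1).
  by apply: shift_eq => //; move: H1; rewrite /H; case: e1 => ->; lia.
have sh2 : vtx x s t3 = shift (e * d%:Z) (vtx x s t4).
  by apply: shift_eq => //; move: H2; rewrite /H; case: e1 => ->; lia.
have l23 := leq_trans l20 l03.
exists (take t1 s), (seg s t1 t2), (seg s t2 t3), (seg s t3 t4), (drop t4 s).
exists (vtx x s t1), (vtx x s t4), d%:Z.
split; rewrite -?sh1 -?sh2.
- by rewrite !catA !take_seg ?cat_take_drop // ltnW.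
- by rewrite size_seg ?(leq_trans l20) // subn_gt0.
- by lia.
- by have := walk_seg w (leq0n t1); rewrite vtx0 /seg subn0 drop0.
- by apply: walk_seg w (ltnW _).
- exact: walk_seg w _.
- by apply: walk_seg w (ltnW _).
- by move: w; rewrite -{1}(cat_take_drop t4 s) => /walk_catP[].
- move=> z /mem_verts_seg[|r r23 ->].
    by rewrite l23 (leq_trans (ltnW l34)).
  exact: hi.
- rewrite /vtx -(take_seg s l20) endv_cat.
  have -> : seg s t2 t3 = seg s t2 t0 ++ seg s t0 t3.
    have : take t2 s ++ seg s t2 t3 = take t2 s ++ seg s t2 t0 ++ seg s t0 t3.
      by rewrite catA !take_seg.
    by move/eqP; rewrite eqseq_cat // eqxx => /eqP.
  by rewrite mem_verts_cat endv_verts.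
Qed.

Definition reach x y : Prop := exists s, walk x s y.

Lemma walk_reach x s y : walk x s y -> reach x y.
Proof. by exists s. Qed.

Lemma reach_trans y x z : reach x y -> reach y z -> reach x z.
Proof. by move=> [s ws] [p wp]; exists (s ++ p); apply: walk_cat ws wp. Qed.

Lemma reach_mem x s y z : walk x s y -> z \in verts x s -> reach x z /\ reach z y.
Proof.
move=> w /mem_verts_split[s1 [s2 [es <-]]]; move: w; rewrite es => /walk_catP[w1 w2].
by split; [exists s1|exists s2].
Qed.

(** As [M] stays at least [d] beyond [k0], shifting it back leaves it between [k0] and its old
    place. *)
Lemma hump_walkM e k0 x s y y0 s1 X M Y s2 a b d :
  e = 1 \/ e = -1 -> 0 <= k0 <= n%:Z -> inG x ->
  hump_split e k0 x s y y0 s1 X M Y s2 a b d ->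
  walk a (shifts (- (e * d)) M) b.
Proof.
move=> e1 k0G xG [_ _ dN w1 wX wM _ _ hi _].
have aG := walk_end_inG (walk_end_inG xG w1) wX.
rewrite -[a](shift0 a) -[b](shift0 b) -(addrN (e * d)) -!shiftD.
apply: (walk_shift wM) => z zM.
have := walk_inG aG wM zM; have := hi z zM.
by case: e1 => ->; rewrite /shift /=; lia.
Qed.

Lemma hump_cut e k0 x s y y0 s1 X M Y s2 a b d :
  e = 1 \/ e = -1 -> 0 <= k0 <= n%:Z -> inG x ->
  hump_split e k0 x s y y0 s1 X M Y s2 a b d ->
  walk x (s1 ++ shifts (- (e * d)) M ++ s2) y.
Proof.
move=> e1 k0G xG hs; have wM := hump_walkM e1 k0G xG hs.
by apply: walk_cat (hs_w1 hs) (walk_cat wM (hs_w2 hs)).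
Qed.

Lemma hump_walkXMY e k0 x s y y0 s1 X M Y s2 a b d :
  hump_split e k0 x s y y0 s1 X M Y s2 a b d -> walk a (X ++ M ++ Y) b.
Proof. by move=> hs; apply: walk_cat (hs_wX hs) (walk_cat (hs_wM hs) (hs_wY hs)). Qed.

(** The shifted [X M Y] fits between a first [X] and a last [Y]; since [d] is at most N^2, vertices
    in [inA] stay in the unfolding. *)
Lemma hump_pump e k0 x s y y0 s1 X M Y s2 a b d :
  e = 1 \/ e = -1 ->
  hump_split e k0 x s y y0 s1 X M Y s2 a b d ->
  (forall z, z \in verts a (X ++ M ++ Y) -> inA z) ->
  walk x (s1 ++ X ++ shifts (e * d) (X ++ M ++ Y) ++ Y ++ s2) y.
Proof.
move=> e1 hs sA.
apply: walk_cat (hs_w1 hs) (walk_cat (hs_wX hs) _).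
apply: walk_cat (walk_cat (hs_wY hs) (hs_w2 hs)).
apply: walk_shift (hump_walkXMY hs) _ => z /sA.
by have := hs_d hs; case: e1 => ->; rewrite /shift /=; lia.
Qed.

(** Cutting gives [c], repeating gives [c'], and [s] is their average for weight and length. So if
    [s] minimizes a linear function of the two, so does the shorter walk [c]. *)
Lemma cut_pump e k0 x s y p t q y0 : e = 1 \/ e = -1 ->
  inG x -> walk x s y -> s = p ++ t ++ q ->
  0 <= k0 <= n%:Z -> hump e k0 (endv x p) t (endv (endv x p) t) y0 ->
  (forall z, z \in verts (endv x p) t -> inA z) ->
  exists c c', [/\ walk x c y, walk x c' y, (size p <= size c < size s)%N,
    wt c + wt c' = 2 * wt s & (size c + size c' = 2 * size s)%N].
Proof.
move=> e1 xG w es k0G h tA; move: w; rewrite es => /walk_catP[wp].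
case/walk_catP=> _ wq; have tG := walk_end_inG xG wp.
have [s1 [X [M [Y [s2 [a [b [d hs]]]]]]]] := hump_splitP e1 h.
exists (p ++ (s1 ++ shifts (- (e * d)) M ++ s2) ++ q).
exists (p ++ (s1 ++ X ++ shifts (e * d) (X ++ M ++ Y) ++ Y ++ s2) ++ q).
split.
- exact: walk_cat wp (walk_cat (hump_cut e1 k0G tG hs) wq).
- apply: walk_cat wp (walk_cat (hump_pump e1 hs _) wq) => z zX.
  apply: tA; rewrite (hs_eq hs) mem_verts_cat (proj2 (hs_w1 hs)).
  have -> : X ++ M ++ Y ++ s2 = (X ++ M ++ Y) ++ s2 by rewrite -!catA.
  by rewrite mem_verts_cat zX orbT.
- have := hs_X hs; rewrite (hs_eq hs) !size_cat size_shifts; lia.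
- by rewrite (hs_eq hs) !shifts_cat !wt_cat !wt_shifts; lia.
- by rewrite (hs_eq hs) !shifts_cat !size_cat !size_shifts; lia.
Qed.

(** * Shortest walks and walks without long corners *)

Lemma ex_min (P : nat -> Prop) : (exists k, P k) ->
  exists m, P m /\ forall k, P k -> (m <= k)%N.
Proof.
case=> k; elim/ltn_ind: k => k IH Pk.
have [[j [jk Pj]]|no] := classic (exists j, (j < k)%N /\ P j); first exact: IH jk Pj.
exists k; split=> // j Pj; rewrite leqNgt; apply/negP => jk.
by apply: no; exists j.
Qed.

Definition shortest x s y : Prop :=
  walk x s y /\ forall s', walk x s' y -> (size s <= size s')%N.

Lemma shortest_ex x y : reach x y -> exists s, shortest x s y.
Proof.
case=> s0 w0; have [|m [[s [w <-]] mn]] :=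
  @ex_min (fun k => exists s, walk x s y /\ size s = k).
  by exists (size s0), s0.
by exists s; split=> // s' w'; apply: mn; exists s'.
Qed.

(** Cutting shortens and needs no distance from the border, so the hump may lie anywhere and over
    any level [k0]. *)
Lemma shortest_no_hump e k0 x s y p t q y0 : e = 1 \/ e = -1 -> inG x ->
  0 <= k0 <= n%:Z -> shortest x s y -> s = p ++ t ++ q ->
  ~ hump e k0 (endv x p) t (endv (endv x p) t) y0.
Proof.
move=> e1 xG k0G [w mn] es h; move: w; rewrite es => /walk_catP[wp].
case/walk_catP=> _ wq; have tG := walk_end_inG xG wp.
have [s1 [X [M [Y [s2 [a [b [d hs]]]]]]]] := hump_splitP e1 h.
have := mn _ (walk_cat wp (walk_cat (hump_cut e1 k0G tG hs) wq)).
have := hs_X hs; rewrite es (hs_eq hs) !size_cat size_shifts; lia.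
Qed.

(** Stronger than the absence of long corners: the subwalk may end on the other side of its starting
    level. *)
Definition tame x s : Prop := forall p t q e y0, s = p ++ t ++ q ->
  (forall z, z \in verts (endv x p) t -> inA z) -> e = 1 \/ e = -1 ->
  ~ hump e (endv x p).2 (endv x p) t (endv (endv x p) t) y0.

Lemma shortest_tame x s y : inG x -> shortest x s y -> tame x s.
Proof.
move=> xG sh p t q e y0 es tA e1; apply: shortest_no_hump sh es => //.
by have := tA _ (mem_head _ _); lia.
Qed.

(** A hump within [inA] cannot visit a junction outside it, so it lies in one of the pieces. *)
Lemma tame_cat x s p : tame x s -> tame (endv x s) p -> ~~ inA (endv x s) ->
  tame x (s ++ p).
Proof.
move=> ts tp nA s1 t s2 e y0 es tA e1.
have nin : endv x s \notin verts (endv x s1) t by apply: contra nA => /tA.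
have [[r [er _]]|[r [er ep]]] := subwalk_split es nin; first exact: ts er tA e1.
by move: tA; rewrite er endv_cat => tA; apply: tp ep tA e1.
Qed.

Definition rounds k s := flatten (nseq k s).

Lemma walk_rounds x s k : walk x s x -> walk x (rounds k s) x.
Proof. by move=> w; elim: k => [|k IH] //; apply: walk_cat w IH. Qed.

Lemma tame_rounds x s k : walk x s x -> tame x s -> ~~ inA x ->
  tame x (rounds k s).
Proof.
move=> w ts nA; elim: k => [|k IH].
  case=> [|//] [|//] [|//] e y0 _ _ _ [_ _ _].
  by rewrite inE => /eqP ->; rewrite subrr mulr0; lia.
by apply: tame_cat; rewrite // (proj2 w).
Qed.

Lemma wt_rounds k s : wt (rounds k s) = k%:Z * wt s.
Proof.
elim: k => [|k IH]; first by rewrite mul0r /wt big_nil.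
by rewrite [rounds _ _]/(s ++ rounds k s) wt_cat IH; lia.
Qed.

Lemma tame_normalized u s v : inG u -> walk u s v -> tame u s ->
  extremal n u -> extremal n v -> normalized R n (GPath u s).
Proof.
move=> uG w ts xu xv; split.
  split=> //; last by rewrite /final (proj2 w : last _ _ = v).
  apply/andP; split; last exact: (proj1 w).
  by apply/allP => z zs; rewrite vertexE; apply: walk_inG w zs.
case=> x t [p [q [/= es ->]]] tA [d [lc dN]].
have {}tA z : z \in verts (endv u p) t -> inA z.
  by move=> zt; apply: tA; apply/mapP; exists z.
move: w; rewrite es => /walk_catP[_] /walk_catP[wt _].
have tm := ts p t q _ _ es tA.
(* A corner of extent [d] has a vertex at distance [d] from its starting level, which is the peak of
   a hump. *)
have high e : e = 1 \/ e = -1 -> endv (endv u p) t = endv (endv u p) t ->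
    (endv u p).2 = (endv (endv u p) t).2 ->
    (endv u p).2 + e * d%:Z \in positions (GPath (endv u p) t) -> False.
  move=> e1 _ eq /mapP[y0 y0t ey]; apply: (tm e y0 e1).
  have ey' : y0.2 = (endv u p).2 + e * d%:Z by [].
  by split=> //; rewrite ?ey' -?eq ?subrr ?mulr0 //; case: e1 => ->; lia.
case: lc => [[[_ eq] /= pos]|[[_ eq] /= pos]].
  apply: (high 1) => //; first by left.
  by apply/pos; rewrite /position -/(endv u p); lia.
apply: (high (-1)) => //; first by right.
by apply/pos; rewrite /position -/(endv u p); lia.
Qed.

(** * Closed walks of least mean weight *)

(* The number of vertices of the unfolding. *)
Definition bound : nat := (N * n.+1)%N.

Lemma verts_repeat x s : ~~ uniq (verts x s) -> exists p c q,
  [/\ s = p ++ c ++ q, (0 < size c)%N & endv (endv x p) c = endv x p].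
Proof.
elim: s x => [|[c t] s IHs] x //.
rewrite /= negb_and negbK => /orP[/mem_verts_split[s1 [s2 [-> e]]]|/IHs].
  by exists [::], ((c, t) :: s1), s2.
by case=> p [c' [q [-> c0 e]]]; exists ((c, t) :: p), c', q.
Qed.

Lemma inG_box z : inG z ->
  z \in [seq (i, k%:Z) | i <- enum 'I_N, k <- iota 0 n.+1].
Proof.
case: z => i k kG; apply/allpairsPdep; exists i, `|k|%N.
rewrite mem_enum mem_iota; move: kG => /= kG; split=> //; first by lia.
by congr pair; lia.
Qed.

(** With at least [bound] steps there are more than [bound] vertices on the walk, so one of them
    repeats. *)
Lemma walk_repeat x s y : inG x -> walk x s y -> (bound <= size s)%N ->
  exists p c q, [/\ s = p ++ c ++ q, (0 < size c)%N,
    walk x p (endv x p), walk (endv x p) c (endv x p) & walk (endv x p) q y].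
Proof.
move=> xG w le; have nu : ~~ uniq (verts x s).
  apply: contraL le => un; rewrite -ltnNge.
  have := uniq_leq_size un (fun z zs => inG_box (walk_inG xG w zs)).
  by rewrite size_allpairs size_enum_ord size_iota /= size_map.
have [p [c [q [es c0 e]]]] := verts_repeat nu.
exists p, c, q; move: w; rewrite es => /walk_catP[wp /walk_catP[wc wq]].
by rewrite e in wc wq.
Qed.

Definition max_step : int := \sum_(w <- R) `|w.2|.

Lemma max_step_ge0 : 0 <= max_step.
Proof. by apply: sumr_ge0. Qed.

Lemma step_atom_ge i c d j : step_atom i c d j -> - max_step <= c.
Proof.
have R_ge (w : atom (var N)) : w \in R -> - max_step <= w.2.
  move=> wR; rewrite /max_step (big_rem w) //=.
  by rewrite lerNl (le_trans (ler_norm _)) // normrN lerDl sumr_ge0.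
by case/or3P => /andP[_ /R_ge].
Qed.

Lemma walk_wt_ge x s y : walk x s y -> - (max_step * (size s)%:Z) <= wt s.
Proof.
case=> w _; elim: s x w => [|[c t] s IHs] x; first by rewrite /wt big_nil mulr0.
rewrite is_walk_cons => /and4P[_ _ /step_atom_ge cge /IHs].
have -> : wt ((c, t) :: s) = c + wt s by rewrite /wt big_cons.
by rewrite /= -[(size s).+1]addn1 PoszD; lia.
Qed.

(** The function f of the overview, additive under concatenation; for positive [al] it compares the
    mean weight with [be / al]. *)
Definition fw (al be : int) s : int := al * wt s - be * (size s)%:Z.

Lemma fw_cat al be s p : fw al be (s ++ p) = fw al be s + fw al be p.
Proof. by rewrite /fw wt_cat size_cat PoszD !mulrDr opprD addrACA. Qed.

Lemma fw_nil al be : fw al be [::] = 0.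
Proof. by rewrite /fw /wt big_nil !mulr0 subr0. Qed.

Variables u v : V.
Hypothesis uG : inG u.

Definition between z : Prop := reach u z /\ reach z v.

Lemma between_inG z : between z -> inG z.
Proof. by case=> [[s w] _]; apply: walk_end_inG w. Qed.

Lemma between_mem x s y z : reach u x -> reach y v -> walk x s y ->
  z \in verts x s -> between z.
Proof.
move=> ux yv w zs; have [xz zy] := reach_mem w zs.
by split; [apply: reach_trans xz|apply: reach_trans yv].
Qed.

Lemma closed_fw_ge0 al be :
  (forall z c, between z -> walk z c z -> (0 < size c <= bound)%N ->
     0 <= fw al be c) ->
  forall z c, between z -> walk z c z -> 0 <= fw al be c.
Proof.
move=> short z c; have [k] := ubnP (size c); elim: k z c => // k IH z [|[c t] s] ck Sz w.
  by rewrite fw_nil.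
have [le|lt] := leqP (size ((c, t) :: s)) bound; first exact: short Sz w _.
(* Setting the first step aside makes the closed part found in [s] strictly shorter than the whole
   walk. *)
have w1 : walk z [:: (c, t)] t /\ walk t s z by exact: (@walk_catP z [:: (c, t)]).
have [p [q [r [es q0 wp wq wr]]]] :=
  walk_repeat (walk_end_inG (between_inG Sz) w1.1) w1.2 lt.
have St : between (endv t p).
  by apply: between_mem Sz.1 Sz.2 w _; rewrite es in_cons [_ \in _]mem_verts_cat endv_verts orbT.
have -> : fw al be ((c, t) :: s) = fw al be ((c, t) :: p ++ r) + fw al be q.
  have fw_cons := fw_cat al be [:: (c, t)].
  by rewrite es [LHS]fw_cons [fw _ _ (_ :: p ++ r)]fw_cons !fw_cat; lia.
move: ck; rewrite es /= !size_cat => ck; apply: addr_ge0.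
  apply: IH Sz _; first by rewrite /= size_cat; lia.
  exact: walk_cat w1.1 (walk_cat wp wr).
by apply: IH St wq; lia.
Qed.

Lemma int_min (P : int -> Prop) L : (exists m, P m) -> (forall m, P m -> L <= m) ->
  exists m, P m /\ forall k, P k -> m <= k.
Proof.
move=> [m Pm] lb; have [|k [Pk mn]] := @ex_min (fun k => P (L + k%:Z)).
  by exists `|m - L|%N; have := lb m Pm => le; have -> : L + `|m - L|%N = m by lia.
exists (L + k%:Z); split=> // j Pj; have le := lb j Pj.
by have := mn `|j - L|%N; have -> : L + `|j - L|%N = j by [lia]; move=> /(_ Pj); lia.
Qed.

Lemma tame_of_nonneg :
  (forall z c, between z -> walk z c z -> 0 <= wt c) -> reach u v ->
  exists s, [/\ walk u s v, tame u s & forall s', walk u s' v -> wt s <= wt s'].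
Proof.
move=> pos [s0 w0].
(* Removing closed parts of nonnegative weight leaves fewer than [bound] steps, so weights are
   bounded below and a minimum exists. *)
have lb s : walk u s v -> - (max_step * bound%:Z) <= wt s.
  have [k] := ubnP (size s); elim: k s => // k IH s sk w.
  have [le|lt] := leqP bound (size s).
    have [p [c [q [es c0 wp wc wq]]]] := walk_repeat uG w le.
    have Sp : between (endv u p) by split; [exists p|exists q].
    have := pos _ _ Sp wc; move: sk; rewrite es !wt_cat !size_cat => sk.
    by have := IH (p ++ q) _ (walk_cat wp wq); rewrite size_cat wt_cat; lia.
  by have := walk_wt_ge w; have := max_step_ge0; nia.
have [||m [[s1 [w1 e1]] mn]] :=
  @int_min (fun m => exists s, walk u s v /\ wt s = m) (- (max_step * bound%:Z)).
- by exists (wt s0), s0.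
- by move=> m [s [w <-]]; apply: lb.
have [|k [[s [w [e ek]]] mn']] :=
  @ex_min (fun k => exists s, walk u s v /\ (wt s = m /\ size s = k)).
  by exists (size s1), s1.
exists s; split=> // [|s' w']; last by rewrite e; apply: mn; exists s'.
move=> p t q d y0 es tA d1 h.
have k0G : 0 <= (endv u p).2 <= n%:Z by have := tA _ (mem_head _ _); lia.
have [c [c' [wc wc' sz we _]]] := cut_pump d1 uG w es k0G h tA.
(* Both weights are at least [m] and their sum is [2 * m]. *)
have := mn (wt c); have := mn (wt c'); rewrite e in we.
move=> /(_ (ex_intro _ c' (conj wc' erefl))) m1 /(_ (ex_intro _ c (conj wc erefl))) m2.
have ec : wt c = m by lia.
have := mn' (size c) (ex_intro _ c (conj wc (conj ec erefl))); lia.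
Qed.

Definition critical al be z : Prop :=
  between z /\ exists c, [/\ walk z c z, (0 < size c)%N & fw al be c = 0].

Lemma critical_ex :
  (exists z c, [/\ between z, walk z c z & wt c < 0]) ->
  exists al be, [/\ 0 < al, be < 0,
    forall z c, between z -> walk z c z -> 0 <= fw al be c &
    exists z, critical al be z].
Proof.
move=> [z0 [c0 [Sz0 w0 neg0]]].
(* Comparing wt c / size c over the short closed walks c amounts to comparing
   the integers wt c * (bound`! / size c). *)
pose P (m : int) := exists z c, [/\ between z, walk z c z, (0 < size c <= bound)%N &
  m = wt c * (bound`! %/ size c)%:Z].
have scale (c : seq (int * V)) : (0 < size c <= bound)%N ->
    (size c)%:Z * (bound`! %/ size c)%:Z = (bound`!)%:Z.
  by move=> cb; rewrite -PoszM mulnC divnK // dvdn_fact.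
(* Otherwise [closed_fw_ge0], with f the weight itself, would make [wt c0] nonnegative. *)
have [m [Pm m0]] : exists m, P m /\ m < 0.
  apply: NNPP => no; have := @closed_fw_ge0 1 0 _ z0 c0 Sz0 w0.
  rewrite {2}/fw mul1r mul0r subr0 => pos; suff : 0 <= wt c0 by lia.
  apply: pos => z c Sz w cb; rewrite /fw mul1r mul0r subr0 leNgt.
  apply/negP => neg; apply: no; exists (wt c * (bound`! %/ size c)%:Z).
  split; first by exists z, c.
  by have := scale c cb; have := fact_gt0 bound; nia.
have [||mu [Pmu mn]] := @int_min P (- (max_step * (bound`!)%:Z)).
- by exists m.
- move=> k [z [c [Sz w cb ->]]]; rewrite -(scale c cb).
  by rewrite mulrA -mulNr ler_wpM2r // (walk_wt_ge w).
(* For a short closed walk, f is then its length times the excess of its scaled mean over the least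
   one, [mu]. *)
exists (bound`!)%:Z, mu; split.
- by rewrite ltz_nat fact_gt0.
- by have := mn _ Pm; lia.
- apply: closed_fw_ge0 => z c Sz w cb; have := mn (wt c * (bound`! %/ size c)%:Z).
  move=> /(_ (ex_intro _ z (ex_intro _ c (And4 Sz w cb erefl)))) le.
  rewrite /fw -(scale c cb) [mu * _]mulrC -mulrA -mulrBr mulr_ge0 //.
  by rewrite subr_ge0 [_ * wt c]mulrC.
have [z [c [Sz w cb e]]] := Pmu.
exists z; split=> //; exists c; split=> //; first by case/andP: cb.
by rewrite /fw -(scale c cb) e -mulrA mulrC [_ * wt c]mulrC subrr.
Qed.

(** * Normalized walks through a critical vertex *)

Section Critical.
Variables al be : int.
Hypotheses (al_gt0 : 0 < al) (be_lt0 : be < 0).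
Hypothesis closed_ge0 : forall z c, between z -> walk z c z -> 0 <= fw al be c.

Lemma critical_neg c : (0 < size c)%N -> fw al be c = 0 -> wt c < 0.
Proof. by rewrite /fw => c0 e; nia. Qed.

Lemma tame_out z : critical al be z -> ~~ inA z -> forall W : int, exists s,
  [/\ walk u s v, tame u s & wt s <= W].
Proof.
case=> [Sz [c0 [w0 s0 e0]]] nA W.
have [|k [[C [wC sC eC ek]] mn]] := @ex_min (fun k => exists c,
  [/\ walk z c z, (0 < size c)%N, fw al be c = 0 & size c = k]).
  by exists (size c0), c0.
have tC : tame z C.
  move=> p t q d y0 es tA d1 h.
  have k0G : 0 <= (endv z p).2 <= n%:Z by have := tA _ (mem_head _ _); lia.
  have [c [c' [wc wc' sz we se]]] := cut_pump d1 (between_inG Sz) wC es k0G h tA.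
  (* The hump lies in [inA], so it cannot start at [z]; this is what makes [c] nonempty. *)
  have p0 : (0 < size p)%N.
    case: p {es h sz wc wc' k0G} tA => // tA.
    by have := tA _ (mem_head _ _); rewrite (negbTE nA).
  have fge := closed_ge0 Sz wc; have fge' := closed_ge0 Sz wc'.
  have ef : fw al be c + fw al be c' = 2 * fw al be C.
    by rewrite /fw addrACA -mulrDr -opprD -mulrDr we -PoszD se PoszM; lia.
  (* Two nonnegative values with sum 0. *)
  have fc : fw al be c = 0 by lia.
  have c_gt0 : (0 < size c)%N by lia.
  have := mn (size c) (ex_intro _ c (And4 wc c_gt0 fc erefl)); lia.
have [P shP] := shortest_ex Sz.1; have [Q shQ] := shortest_ex Sz.2.
have zG := between_inG Sz; have wK k' := walk_rounds k' wC.
have neg := critical_neg sC eC.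
(* Each round weighs at most -1, so this many bring the weight down to [W]. *)
exists (P ++ rounds `|(wt P + wt Q - W)%R|%N C ++ Q); split.
- exact: walk_cat shP.1 (walk_cat (wK _) shQ.1).
- apply: tame_cat; rewrite ?(proj2 shP.1) //; first exact: shortest_tame shP.
  apply: tame_cat; rewrite ?(proj2 (wK _)) //; first exact: tame_rounds.
  exact: shortest_tame shQ.
- by rewrite !wt_cat wt_rounds; nia.
Qed.

(** Rotating the cycle changes neither its weight nor its length. *)
Lemma critical_mem z C y : between z -> walk z C z -> (0 < size C)%N ->
  fw al be C = 0 -> y \in verts z C -> critical al be y.
Proof.
move=> Sz wC sC eC yC; split; first exact: between_mem Sz.1 Sz.2 wC yC.
have [c1 [c2 [ec ey]]] := mem_verts_split yC.
move: wC sC eC; rewrite ec => /walk_catP[w1 w2]; rewrite ey in w1 w2.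
move=> sC eC; exists (c2 ++ c1); split; first exact: walk_cat w2 w1.
  by rewrite size_cat addnC -size_cat.
by rewrite fw_cat addrC -fw_cat.
Qed.

(** The hump may belong to another walk: cutting only needs [X M Y] to be a factor of [s]. *)
Lemma shortest_no_cut e k0 x0 t y0' y0 s1 X M Y s2 a b d x s y p q :
  e = 1 \/ e = -1 -> 0 <= k0 <= n%:Z -> inG x0 ->
  hump_split e k0 x0 t y0' y0 s1 X M Y s2 a b d ->
  s = p ++ (X ++ M ++ Y) ++ q -> endv x p = a -> ~ shortest x s y.
Proof.
move=> e1 k0G xG hs es ea [w mn].
have wM := hump_walkM e1 k0G xG hs; have wXMY := hump_walkXMY hs.
move: w; rewrite es => /walk_catP[wp /walk_catP[_ wq]].
rewrite ea in wp wq; rewrite (proj2 wXMY) in wq.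
have := mn _ (walk_cat wp (walk_cat wM wq)); have := hs_X hs.
by rewrite es !size_cat size_shifts; lia.
Qed.

(** Replacing [M] by [X M Y] shifted down keeps the end points of [M] and lowers the tracked vertex
    [y] by [d]. This is possible while [M] stays at positions at least N^2, so it must lead below
    N^2. *)
Lemma pump_down a b d X Y : 0 < d <= (N ^ 2)%N%:Z ->
  walk a X (shift (- d) a) -> walk (shift (- d) b) Y b ->
  (forall z, z \in verts a X -> inA z) ->
  (forall z, z \in verts (shift (- d) b) Y -> inA z) ->
  forall M y, walk (shift (- d) a) M (shift (- d) b) ->
  (forall z, z \in verts (shift (- d) a) M -> 0 <= z.2 <= n%:Z - (N ^ 2)%N%:Z) ->
  y \in verts (shift (- d) a) M ->
  exists2 y', y'.2 < (N ^ 2)%N%:Z &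
    reach (shift (- d) a) y' /\ reach y' (shift (- d) b).
Proof.
move=> dN wX wY XA YA M y; have [k] := ubnP `|y.2|%N.
elim: k M y => // k IH M y yk wM MA yM.
have [lt|ge] := ltP y.2 (N ^ 2)%N%:Z; first by exists y; last exact: reach_mem yM.
have [|no] := boolP (has (fun z : V => z.2 < (N ^ 2)%N%:Z) (verts (shift (- d) a) M)).
  by case/hasP=> z zM lt; exists z; last exact: reach_mem zM.
have {}no z : z \in verts (shift (- d) a) M -> (N ^ 2)%N%:Z <= z.2.
  by move=> zM; rewrite leNgt; apply: contra no => lt; apply/hasP; exists z.
have wX' : walk (shift (- d) a) (shifts (- d) X) (shift (- d) (shift (- d) a)).
  by apply: (walk_shift wX) => z /XA; rewrite /shift /=; lia.
have wM' := walk_shift (d := - d) wM.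
have {}wM' : walk (shift (- d) (shift (- d) a)) (shifts (- d) M)
    (shift (- d) (shift (- d) b)).
  by apply: wM' => z zM; have := no z zM; have := MA z zM; rewrite /shift /=; lia.
have wY' : walk (shift (- d) (shift (- d) b)) (shifts (- d) Y) (shift (- d) b).
  by apply: (walk_shift wY) => z /YA; rewrite /shift /=; lia.
apply: (IH (shifts (- d) X ++ shifts (- d) M ++ shifts (- d) Y) (shift (- d) y)).
- by have := yk; rewrite /shift /=; lia.
- exact: walk_cat wX' (walk_cat wM' wY').
- move=> z; rewrite mem_verts_cat (proj2 wX') mem_verts_cat (proj2 wM').
  rewrite !verts_shifts => /or3P[] /mapP[z' zz ->].
  + by have := XA z' zz; rewrite /shift /=; lia.
  + by have := no z' zz; have := MA z' zz; rewrite /shift /=; lia.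
  + by have := YA z' zz; rewrite /shift /=; lia.
- rewrite mem_verts_cat (proj2 wX') mem_verts_cat !verts_shifts.
  by rewrite (map_f _ yM) orbT.
Qed.

(** * The case where all critical vertices satisfy [inA] *)

Section Top.
Hypothesis critical_inA : forall z, critical al be z -> inA z.
Variables (z : V) (C : seq (int * V)).
Hypotheses (zu : between z) (wC : walk z C z) (sC : (0 < size C)%N).
Hypotheses (fC : fw al be C = 0).
Hypothesis ztop : forall y, critical al be y -> y.2 <= z.2.

Lemma cycle_inA y : y \in verts z C -> inA y.
Proof. by move=> yC; apply: critical_inA; apply: critical_mem yC. Qed.

(** The shifted cycle would make [shift d z] critical, above the highest critical vertex [z]. *)
Lemma top_shift y d : y \in verts z C -> 0 < d <= (N ^ 2)%N%:Z ->
  ~ between (shift d y).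
Proof.
move=> yC dN [ry yr].
have CG z' : z' \in verts z C -> inG (shift d z').
  by move/cycle_inA; rewrite /shift /=; lia.
have wC' := walk_shift wC CG.
have yC' : shift d y \in verts (shift d z) (shifts d C).
  by rewrite verts_shifts map_f.
have [zy yz] := reach_mem wC' yC'.
have cr : critical al be (shift d z).
  split; first by split; [apply: reach_trans yz|apply: reach_trans yr].
  exists (shifts d C); split=> //; first by rewrite size_shifts.
  by rewrite /fw wt_shifts size_shifts.
by have := ztop cr; rewrite /shift /=; lia.
Qed.

Variables (w1 w2 : V) (P Q : seq (int * V)) (k : nat).
Hypotheses (uw1 : reach u w1) (w2v : reach w2 v).
Hypotheses (shP : shortest w1 P z) (shQ : shortest z Q w2).
Hypothesis w1_low : w1.2 < (N ^ 2)%N%:Z \/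
  forall y, reach u y -> reach y z -> (N ^ 2)%N%:Z <= y.2.
Hypothesis w2_low : w2.2 < (N ^ 2)%N%:Z \/
  forall y, reach z y -> reach y v -> (N ^ 2)%N%:Z <= y.2.
Let K := rounds k C.

Lemma rounds_mem y : y \in verts z K -> y \in verts z C.
Proof.
rewrite /K; elim: k => [|j IH]; first by rewrite inE => /eqP ->; apply: mem_head.
rewrite [rounds _ _]/(C ++ rounds j C) mem_verts_cat (proj2 wC).
by case/orP.
Qed.

Let w1G : inG w1. Proof. by case: uw1 => s; apply: walk_end_inG. Qed.
Let zG : inG z. Proof. exact: between_inG. Qed.
Let wK : walk z K z. Proof. exact: walk_rounds. Qed.
Let wT : walk w1 (P ++ K ++ Q) w2.
Proof. exact: walk_cat shP.1 (walk_cat wK shQ.1). Qed.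

(** Both junctions are [z], which [t] misses, so [t] lies in [P], [K] or [Q]; in [K] it would meet
    the cycle. *)
Lemma avoid_cycle p t q : P ++ K ++ Q = p ++ t ++ q ->
  (forall y, y \in verts (endv w1 p) t -> y \notin verts z C) ->
  (exists r, P = p ++ t ++ r /\ q = r ++ K ++ Q) \/
  (exists r, p = (P ++ K) ++ r /\ Q = r ++ t ++ q).
Proof.
move=> e no; have zt : z \notin verts (endv w1 p) t.
  by apply/negP => /no /negP; apply; apply: mem_head.
have eP : endv w1 P = z := proj2 shP.1.
rewrite -eP in zt; have [?|[r [ep er]]] := subwalk_split e zt; first by left.
have epr : endv w1 p = endv z r by rewrite ep endv_cat eP.
rewrite eP epr -{1}(proj2 wK) in zt.
have [[r' [eK _]]|[r' [er' eQ]]] := subwalk_split er zt.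
  have /no/negP[] := mem_head (endv w1 p) [seq e.2 | e <- t].
  by apply: rounds_mem; rewrite eK epr mem_verts_cat endv_verts.
by right; exists r'; rewrite ep er' catA.
Qed.

Lemma tame_right p t q y0 : P ++ K ++ Q = p ++ t ++ q ->
  (forall y, y \in verts (endv w1 p) t -> inA y) ->
  ~ hump 1 (endv w1 p).2 (endv w1 p) t (endv (endv w1 p) t) y0.
Proof.
move=> es tA h; have e1 : (1 : int) = 1 \/ (1 : int) = -1 by left.
have k0G : 0 <= (endv w1 p).2 <= n%:Z by have := tA _ (mem_head _ _); lia.
have := wT; rewrite es => /walk_catP[wp /walk_catP[_ wq]].
have xG := walk_end_inG w1G wp.
have [s1 [X [M [Y [s2 [a [b [d hs]]]]]]]] := hump_splitP e1 h.
have ua : reach u a.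
  exact: reach_trans uw1 (reach_trans (walk_reach wp) (walk_reach (hs_w1 hs))).
have bv : reach b v.
  exact: reach_trans (reach_trans (walk_reach (hs_w2 hs)) (walk_reach wq)) w2v.
have wXMY := hump_walkXMY hs.
have XMYt y : y \in verts a (X ++ M ++ Y) -> y \in verts (endv w1 p) t.
  move=> yt; rewrite (hs_eq hs) mem_verts_cat (proj2 (hs_w1 hs)).
  have -> : X ++ M ++ Y ++ s2 = (X ++ M ++ Y) ++ s2 by rewrite -!catA.
  by rewrite mem_verts_cat yt orbT.
(* Otherwise the repeated hump passes through [shift d y]. *)
have no y : y \in verts a (X ++ M ++ Y) -> y \notin verts z C.
  move=> yt; apply/negP => yC; apply: (top_shift yC (hs_d hs)).
  have w' : walk (shift d a) (shifts d (X ++ M ++ Y)) (shift d b).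
    apply: (walk_shift wXMY) => y' /XMYt /tA.
    by have := hs_d hs; rewrite /shift /=; lia.
  have := hs_wX hs; have := hs_wY hs; rewrite mul1r => wY wX.
  apply: between_mem _ _ w' _; last by rewrite verts_shifts map_f.
    by apply: reach_trans ua _; exists X.
  by apply: reach_trans bv; exists Y.
have es' : P ++ K ++ Q = (p ++ s1) ++ (X ++ M ++ Y) ++ (s2 ++ q).
  by rewrite es (hs_eq hs) -!catA.
have ea : endv w1 (p ++ s1) = a by rewrite endv_cat (proj2 (hs_w1 hs)).
have [|[r [eP _]]|[r [ep eQ]]] := avoid_cycle es'; first by rewrite ea.
  exact: shortest_no_cut e1 k0G xG hs eP ea shP.
apply: shortest_no_cut e1 k0G xG hs eQ _ shQ.
by rewrite -ea ep !endv_cat (proj2 shP.1) (proj2 wK).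
Qed.

Lemma tame_left p t q y0 : P ++ K ++ Q = p ++ t ++ q ->
  (forall y, y \in verts (endv w1 p) t -> inA y) ->
  ~ hump (-1) (endv w1 p).2 (endv w1 p) t (endv (endv w1 p) t) y0.
Proof.
move=> es tA h; have e1 : (-1 : int) = 1 \/ (-1 : int) = -1 by right.
have k0G : 0 <= (endv w1 p).2 <= n%:Z by have := tA _ (mem_head _ _); lia.
have := wT; rewrite es => /walk_catP[wp /walk_catP[_ wq]].
have xG := walk_end_inG w1G wp.
have [s1 [X [M [Y [s2 [a [b [d hs]]]]]]]] := hump_splitP e1 h.
have ua : reach u a.
  exact: reach_trans uw1 (reach_trans (walk_reach wp) (walk_reach (hs_w1 hs))).
have bv : reach b v.
  exact: reach_trans (reach_trans (walk_reach (hs_w2 hs)) (walk_reach wq)) w2v.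
have wM' := hump_walkM e1 k0G xG hs.
have [et _ dN w1a wX wM wY wb _ y0M] := hs.
rewrite mulN1r opprK in wM'; rewrite mulN1r in wX wM wY y0M.
have XMYt y : y \in verts a (X ++ M ++ Y) -> y \in verts (endv w1 p) t.
  move=> yt; rewrite et mem_verts_cat (proj2 w1a).
  have -> : X ++ M ++ Y ++ s2 = (X ++ M ++ Y) ++ s2 by rewrite -!catA.
  by rewrite mem_verts_cat yt orbT.
have XA y : y \in verts a X -> inA y.
  by move=> yX; apply/tA/XMYt; rewrite mem_verts_cat yX.
have MA y : y \in verts (shift (- d) a) M -> inA y.
  move=> yM; apply/tA/XMYt.
  by rewrite mem_verts_cat (proj2 wX) mem_verts_cat yM orbT.
have YA y : y \in verts (shift (- d) b) Y -> inA y.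
  move=> yY; apply/tA/XMYt.
  by rewrite mem_verts_cat (proj2 wX) mem_verts_cat (proj2 wM) yY !orbT.
(* Otherwise the cut, which shifts [M] up by [d], passes through [shift d y]. *)
have no y : y \in verts (shift (- d) a) M -> y \notin verts z C.
  move=> yM; apply/negP => yC; apply: (top_shift yC dN).
  apply: between_mem ua bv wM' _.
  by have := map_f (shift d) yM; rewrite -verts_shifts shiftD addNr shift0.
have [y' y'_low [ay' y'b]] : exists2 y', y'.2 < (N ^ 2)%N%:Z &
    reach (shift (- d) a) y' /\ reach y' (shift (- d) b).
  apply: (pump_down dN wX wY XA YA wM _ y0M) => y /MA; lia.
have y0A := MA _ y0M.
have y0h := hump_high h; have x1h := hump_end h.
have [M1 [M2 [eM ey0]]] := mem_verts_split y0M.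
have es' : P ++ K ++ Q = (p ++ s1 ++ X) ++ M ++ (Y ++ s2 ++ q).
  by rewrite es et -!catA.
have ea : endv w1 (p ++ s1 ++ X) = shift (- d) a.
  by rewrite !endv_cat (proj2 w1a) (proj2 wX).
have ea' : endv w1 (p ++ s1) = a by rewrite endv_cat (proj2 w1a).
have [|[r [eP er]]|[r [ep eQ]]] := avoid_cycle es'; first by rewrite ea.
  (* If [Y] ends within [P], all of [X M Y] can be cut there. If not, [Y] passes through [z], so
     [y'] lies on a walk from [u] to [z] and [w1] is below N^2. *)
  have [le|lt] := leqP (size Y) (size r).
    have [r' [er' _]] := cat_prefix er le; rewrite er' in eP.
    by apply: shortest_no_cut e1 k0G xG hs _ ea' shP; rewrite eP -!catA.
  have [Y2 [eY _]] := cat_prefix (esym er) (ltnW lt).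
  have bz : reach (shift (- d) b) z.
    exists r; move: wY; rewrite eY => /walk_catP[]; rewrite -(proj2 shP.1) eP.
    by rewrite [endv w1 _]endv_cat ea endv_cat (proj2 wM).
  case: w1_low => [low|high]; last first.
    have uy' : reach u y'.
      by apply: reach_trans ay'; apply: reach_trans ua _; exists X.
    by have := high _ uy' (reach_trans y'b bz); rewrite leNgt y'_low.
  (* [P] starts at [w1], below [y0], climbs to the start of [t] and returns to [y0]: a right hump
     over the level of [y0]. *)
  have eP' : P = [::] ++ (p ++ s1 ++ X ++ M1) ++ (M2 ++ r) by rewrite eP eM -!catA.
  have ey : endv w1 (p ++ s1 ++ X ++ M1) = y0.
    by rewrite !endv_cat (proj2 w1a) (proj2 wX).
  apply: (@shortest_no_hump 1 y0.2 _ _ _ _ _ _ (endv w1 p) _ w1G _ shP eP').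
  - by left.
  - lia.
  have en : endv w1 [::] = w1 by [].
  split; rewrite ?en ?ey.
  - by have := shP.1; rewrite eP' => /walk_catP[_ /walk_catP[]]; rewrite ?en ?ey.
  - lia.
  - by rewrite subrr mulr0.
  - by rewrite mem_verts_cat endv_verts.
  - lia.
rewrite catA in ep.
(* The mirror case: either [X] starts within [Q], or it passes through [z] and [w2] is below N^2. *)
have [le|lt] := leqP (size (P ++ K)) (size (p ++ s1)).
  have [r' [ep' er]] := cat_prefix (esym ep) le.
  apply: shortest_no_cut e1 k0G xG hs _ _ shQ; first by rewrite eQ er -!catA.
  by rewrite -ea' ep' !endv_cat (proj2 shP.1) (proj2 wK).
have [X1 [eX er]] := cat_prefix ep (ltnW lt).
have zX : endv a X1 = z.
  by rewrite -ea' -endv_cat -eX endv_cat (proj2 shP.1) (proj2 wK).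
have za : reach z (shift (- d) a).
  by exists r; move: wX; rewrite er => /walk_catP[_]; rewrite zX.
case: w2_low => [low|high]; last first.
  have y'v : reach y' v.
    by apply: reach_trans y'b _; apply: reach_trans bv; exists Y.
  by have := high _ (reach_trans za ay') y'v; rewrite leNgt y'_low.
(* From [y0], [Q] climbs to the end of [t] and then falls to [w2], below [y0]. *)
have eQ' : Q = (r ++ M1) ++ (M2 ++ Y ++ s2 ++ q) ++ [::] by rewrite cats0 eQ eM -!catA.
have zr : endv z r = shift (- d) a by rewrite -zX -endv_cat -er (proj2 wX).
have ey : endv z (r ++ M1) = y0 by rewrite endv_cat zr.
have ew2 : endv y0 (M2 ++ Y ++ s2 ++ q) = w2.
  by rewrite -ey -endv_cat -(proj2 shQ.1) [in RHS]eQ' cats0.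
apply: (@shortest_no_hump 1 y0.2 _ _ _ _ _ _ (endv (endv w1 p) t) _ zG _ shQ eQ').
- by left.
- lia.
split; rewrite ?ey ?ew2.
- have := shQ.1; rewrite eQ' => /walk_catP[_ /walk_catP[]].
  by rewrite ?ey ?ew2.
- by rewrite subrr mulr0.
- lia.
- have -> : endv (endv w1 p) t = endv y0 (M2 ++ Y ++ s2).
    rewrite et !endv_cat (proj2 w1a) (proj2 wX) eM !endv_cat ey0.
    by [].
  have -> : M2 ++ Y ++ s2 ++ q = (M2 ++ Y ++ s2) ++ q by rewrite -!catA.
  by rewrite mem_verts_cat endv_verts.
- lia.
Qed.

Lemma tame_through : tame w1 (P ++ K ++ Q).
Proof.
by move=> p t q e y0 es tA [->|->]; [apply: tame_right es tA|apply: tame_left es tA].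
Qed.
End Top.

(** Shortest walks from [u] to [w1] and from [w2] to [v] complete the walk through the cycle; as
    [w1] and [w2] are outside [inA], no new hump arises. *)
Lemma tame_in z0 : ~~ inA u -> ~~ inA v -> critical al be z0 ->
  (forall z, critical al be z -> inA z) -> forall W : int, exists s,
  [/\ walk u s v, tame u s & wt s <= W].
Proof.
move=> uA vA cr0 crA W.
(* A critical vertex of maximal position, as a minimum of negated positions. *)
have [||m [[z [[Sz [C [wC sC fC]]] em]] mn]] :=
  @int_min (fun m => exists z, critical al be z /\ m = - z.2) (- n%:Z).
- by exists (- z0.2), z0.
- by move=> m [z [[/between_inG zG _] ->]]; lia.
have ztop y : critical al be y -> y.2 <= z.2.
  by move=> cr; have := mn (- y.2) (ex_intro _ y (conj cr erefl)); lia.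
have [w1 [uw1 w1z nA1 low1]] : exists w1, [/\ reach u w1, reach w1 z, ~~ inA w1 &
    w1.2 < (N ^ 2)%N%:Z \/ forall y, reach u y -> reach y z -> (N ^ 2)%N%:Z <= y.2].
  have [[y [uy yz lt]]|no] := classic (exists y, [/\ reach u y, reach y z &
      y.2 < (N ^ 2)%N%:Z]).
    by exists y; split=> //; [rewrite leNgt lt|left].
  exists u; split=> //; [by exists [::]|exact: Sz.1|right=> y uy yz].
  by rewrite leNgt; apply/negP => lt; apply: no; exists y.
have [w2 [zw2 w2v nA2 low2]] : exists w2, [/\ reach z w2, reach w2 v, ~~ inA w2 &
    w2.2 < (N ^ 2)%N%:Z \/ forall y, reach z y -> reach y v -> (N ^ 2)%N%:Z <= y.2].
  have [[y [zy yv lt]]|no] := classic (exists y, [/\ reach z y, reach y v &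
      y.2 < (N ^ 2)%N%:Z]).
    by exists y; split=> //; [rewrite leNgt lt|left].
  exists v; split=> //; [exact: Sz.2|by exists [::]|right=> y zy yv].
  by rewrite leNgt; apply/negP => lt; apply: no; exists y.
have [P0 shP0] := shortest_ex uw1; have [P shP] := shortest_ex w1z.
have [Q shQ] := shortest_ex zw2; have [Q0 shQ0] := shortest_ex w2v.
pose k := `|(wt P0 + wt P + wt Q + wt Q0 - W)%R|%N.
have wT : walk w1 (P ++ rounds k C ++ Q) w2.
  exact: walk_cat shP.1 (walk_cat (walk_rounds k wC) shQ.1).
exists (P0 ++ (P ++ rounds k C ++ Q) ++ Q0); split.
- exact: walk_cat shP0.1 (walk_cat wT shQ0.1).
- apply: tame_cat; rewrite ?(proj2 shP0.1) //; first exact: shortest_tame shP0.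
  apply: tame_cat; rewrite ?(proj2 wT) //.
    exact: (tame_through crA Sz wC sC fC ztop uw1 w2v shP shQ low1 low2).
  apply: shortest_tame shQ0; apply: (walk_end_inG (x := z)) shQ.1.
  exact: between_inG.
- by rewrite !wt_cat wt_rounds; have := critical_neg sC fC; rewrite /k; nia.
Qed.
End Critical.

(** * Assembling the cases *)

Lemma tame_ex s : ~~ inA u -> ~~ inA v -> walk u s v ->
  exists s', [/\ walk u s' v, tame u s' & wt s' <= wt s].
Proof.
move=> uA vA w; have [neg|pos] := classic (exists z c,
  [/\ between z, walk z c z & wt c < 0]); last first.
  have [||s' [w' t' mn]] := tame_of_nonneg.
  - move=> z c Sz wc; rewrite leNgt; apply/negP => lt.
    by apply: pos; exists z, c.
  - by exists s.
  - by exists s'; split=> //; apply: mn.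
have [al [be [al0 be0 ge0 [z0 cr0]]]] := critical_ex neg.
have [[z [cr nA]]|no] := classic (exists z, critical al be z /\ ~~ inA z).
  exact: tame_out ge0 _ cr nA _.
apply: (tame_in al0 be0 uA vA cr0) => z cr.
by apply/negPn/negP => nA; apply: no; exists z.
Qed.
End Unfolding.

Theorem theorem2 (N : nat) (R : dbc N) (n : nat) (rho : gpath (pvar N)) :
  balanced R -> (1 <= n)%N -> extremal_path R n rho ->
  exists rho' : gpath (pvar N), normalized R n rho' /\ compatible rho' rho.
Proof.
case: rho => u s balR n0 [/andP[vs ws] xu xv].
have uG : 0 <= u.2 <= n%:Z by rewrite -(vertexE R n0); case/andP: vs.
(* The vertex [u] exists, so N is positive and positions 0 and n fall outside [inA]. *)
have N0 : (0 < N ^ 2)%N by rewrite expn_gt0 (leq_ltn_trans (leq0n _) (ltn_ord u.1)).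
have nA (z : pvar N) : extremal n z -> ~~ ((N ^ 2)%N%:Z <= z.2 <= n%:Z - (N ^ 2)%N%:Z).
  by case=> e; have : z.2 = _ := e; lia.
have w : walk R n u s (endv u s) by [].
have [s' [w' t' le]] := tame_ex balR n0 uG (nA _ xu) (nA _ xv) w.
exists (GPath u s'); split; last by split=> //; rewrite /final; case: w'.
exact: (tame_normalized balR n0 uG w' t' xu xv).
Qed.
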